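(* Fix an imprecise probabilities tree with finite state space $\mathscr{X}$, and let $\overline{\mathrm{E}}_{\mathrm V}$ be the corresponding game-theoretic upper expectation. For any $f\colon\Omega\to\overline{\mathbb{R}}$ and any situation $s\in\mathscr{X}^{\ast}$, we have that \[\lim_{\alpha\to-\infty}\overline{\mathrm{E}}_{\mathrm V}(f^{\vee\alpha}\vert s)=\overline{\mathrm{E}}_{\mathrm V}(f\vert s),\] where, for $\alpha\in\mathbb{R}$, $f^{\vee\alpha}(\omega)=\max\{f(\omega),\alpha\}$ for all $\omega\in\Omega$.
   Context: Notation: $\mathbb{N}=\{1,2,\dots\}$, $\mathbb{N}_0=\mathbb{N}\cup\{0\}$, $\overline{\mathbb{R}}=\mathbb{R}\cup\{-\infty,+\infty\}$, with conventions $+\infty-\infty=-\infty+\infty=+\infty$, $0\cdot(\pm\infty)=0$, $\inf\emptyset=+\infty$. For a non-empty set $\mathscr{Y}$, $\overline{\mathscr{L}}(\mathscr{Y})$ is the set of all maps $\mathscr{Y}\to\overline{\mathbb{R}}$ and $\overline{\mathscr{L}}_b(\mathscr{Y})$ the subset of those bounded below by a real constant. Limits and inequalities of functions are pointwise. Local models: $\mathscr{X}$ is a finite non-empty set. $\mathscr{X}^{\ast}=\bigcup_{n\in\mathbb{N}_0}\mathscr{X}^n$ is the set of situations (finite strings, including the empty string $\Box$). An imprecise probabilities tree assigns to each $s\in\mathscr{X}^{\ast}$ a map $\overline{\mathrm{Q}}_s\colon\overline{\mathscr{L}}(\mathscr{X})\to\overline{\mathbb{R}}$ that is an upper expectation,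 i.e. satisfies: (E1) $\overline{\mathrm{Q}}_s(c)=c$ for all $c\in\mathbb{R}$; (E2) $\overline{\mathrm{Q}}_s(f+g)\le\overline{\mathrm{Q}}_s(f)+\overline{\mathrm{Q}}_s(g)$ for all $f,g\in\overline{\mathscr{L}}_b(\mathscr{X})$; (E3) $\overline{\mathrm{Q}}_s(\lambda f)=\lambda\overline{\mathrm{Q}}_s(f)$ for all real $\lambda>0$ and $f\in\overline{\mathscr{L}}_b(\mathscr{X})$; (E4) $f\le g\Rightarrow\overline{\mathrm{Q}}_s(f)\le\overline{\mathrm{Q}}_s(g)$ for all $f,g\in\overline{\mathscr{L}}_b(\mathscr{X})$; (E5) $\lim_n\overline{\mathrm{Q}}_s(f_n)=\overline{\mathrm{Q}}_s(\lim_n f_n)$ for every non-decreasing sequence $\{f_n\}_{n\in\mathbb{N}_0}$ of non-negative variables in $\overline{\mathscr{L}}_b(\mathscr{X})$. Global model: $\Omega=\mathscr{X}^{\mathbb{N}}$ is the set of paths; for $\omega\in\Omega$, $\omega^n\in\mathscr{X}^n$ is the string of its first $n$ values; $\Gamma(x_{1:n})=\{\omega\in\Omega:\omega^n=x_{1:n}\}$. For $g,h\colon\Omega\to\overline{\mathbb{R}}$, $g\ge_s h$ means $g(\omega)\ge h(\omega)$ for all $\omega\in\Gamma(s)$. A supermartingale is a map $\mathscr{M}\colon\mathscr{X}^{\ast}\to\overline{\mathbb{R}}$ with $\overline{\mathrm{Q}}_s(\mathscr{M}(s\,\cdot))\le\mathscr{M}(s)$ for all $s\in\mathscr{X}^{\ast}$,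 where $\mathscr{M}(s\,\cdot)\in\overline{\mathscr{L}}(\mathscr{X})$ is $x\mapsto\mathscr{M}(sx)$. $\overline{\mathbb{M}}_{\mathrm b}$ is the set of supermartingales bounded below by a real constant, and $\liminf\mathscr{M}(\omega)=\liminf_{n\to+\infty}\mathscr{M}(\omega^n)$. The game-theoretic upper expectation is, for all $f\colon\Omega\to\overline{\mathbb{R}}$ and $s\in\mathscr{X}^{\ast}$, \[\overline{\mathrm{E}}_{\mathrm V}(f\vert s)=\inf\{\mathscr{M}(s):\mathscr{M}\in\overline{\mathbb{M}}_{\mathrm b},\ \liminf\mathscr{M}\ge_s f\}.\] *)

(* Defs.v *)
From HB Require Import structures.
From mathcomp Require Import all_boot all_order all_algebra.
From mathcomp Require Import all_classical all_reals all_analysis.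

Set Implicit Arguments.
Unset Strict Implicit.
Unset Printing Implicit Defensive.

Import Order.TTheory GRing.Theory Num.Theory.
Import numFieldNormedType.Exports.

Local Open Scope classical_set_scope.
Local Open Scope ring_scope.
Local Open Scope ereal_scope.

Definition bounded_below (R : realType) (Y : Type) (f : Y -> \bar R) : Prop :=
  exists c : R, forall y, c%:E <= f y.

(* In E2, sums are written with %dE, the dual addition of \bar R, for which
   +oo - oo = -oo + oo = +oo (the default %E addition has -oo there).  In E5,
   bounded_below (f_ n) need not be required: it follows from 0 <= f_ n. *)
Record upper_expectation (R : realType) (X : finType)
    (Q : (X -> \bar R) -> \bar R) : Prop := UpperExpectation {
  upexp_cst : forall c : R, Q (fun=> c%:E) = c%:E;
  upexp_sub : forall f g : X -> \bar R,
    bounded_below f -> bounded_below g ->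
    Q (fun x => (f x + g x)%dE) <= (Q f + Q g)%dE;
  upexp_homo : forall (l : R) (f : X -> \bar R),
    (0 < l)%R -> bounded_below f -> Q (fun x => l%:E * f x) = l%:E * Q f;
  upexp_mono : forall f g : X -> \bar R,
    bounded_below f -> bounded_below g -> (forall x, f x <= g x) -> Q f <= Q g;
  upexp_cvg : forall f_ : nat -> X -> \bar R,
    (forall n x, 0 <= f_ n x) ->
    (forall n x, f_ n x <= f_ n.+1 x) ->
    Q (f_ n) @[n --> \oo] --> Q (fun x => limn (fun n => f_ n x))
}.

(* A situation is a finite sequence of states; [::] is the initial one. *)
Definition imprecise_tree (R : realType) (X : finType)
    (Q : seq X -> (X -> \bar R) -> \bar R) : Prop :=
  forall s, upper_expectation (Q s).

(* Paths are 0-indexed: w 0 is the first state of the path w, so that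
   mkseq w n consists of its first n states. *)
Definition path_of (X : finType) : Type := nat -> X.

Definition cylinder (X : finType) (s : seq X) : set (path_of X) :=
  [set w | mkseq w (size s) = s].

Definition supermartingale (R : realType) (X : finType)
    (Q : seq X -> (X -> \bar R) -> \bar R) (M : seq X -> \bar R) : Prop :=
  forall s, Q s (fun x => M (rcons s x)) <= M s.

Definition liminf_path (R : realType) (X : finType) (M : seq X -> \bar R)
    (w : path_of X) : \bar R :=
  limn_einf (fun n => M (mkseq w n)).

Definition upper_E (R : realType) (X : finType)
    (Q : seq X -> (X -> \bar R) -> \bar R) (f : path_of X -> \bar R)
    (s : seq X) : \bar R :=
  ereal_inf [set M s | M in [set M : seq X -> \bar R |
    [/\ supermartingale Q M, bounded_below M &
        forall w, cylinder s w -> f w <= liminf_path M w]]].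

Definition cut_below (R : realType) (X : finType) (f : path_of X -> \bar R)
    (a : R) : path_of X -> \bar R :=
  fun w => maxe (f w) a%:E.

(* Main.v *)
Require Import Defs.
From HB Require Import structures.
From mathcomp Require Import all_boot all_order all_algebra.
From mathcomp Require Import all_classical all_reals all_analysis.
Import Order.TTheory GRing.Theory Num.Theory.
Import numFieldNormedType.Exports.
Local Open Scope classical_set_scope.
Local Open Scope ring_scope.

(** Raising [f] to the level [a] only raises its upper expectation, so
    [a |-> E(f \/ a)] is nondecreasing and converges, as [a --> -oo], to its
    infimum, which is at least [E(f)].  Conversely, if a supermartingale is
    bounded below by [c], so is its liminf: once it superhedges [f], it also
    superhedges [f \/ c].  Hence the infimum is at most [E(f)]. *)

Lemma limn_einf_ge (R : realType) (u : nat -> \bar R) (c : \bar R) :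
  (forall n, c <= u n)%E -> (c <= limn_einf u)%E.
Proof.
move=> cu; rewrite limn_einf_lim; apply: lime_ge; first exact: is_cvg_einfs.
by apply: nearW => n; apply: le_ereal_inf_tmp => _ [m _ <-].
Qed.

(** Each supermartingale admissible for [g] is admissible for [f], so the infimum for [f] runs over
    a larger set. *)
Lemma upper_E_le (R : realType) (X : finType)
    (Q : seq X -> (X -> \bar R) -> \bar R) (f g : path_of X -> \bar R)
    (s : seq X) :
  (forall w, cylinder s w -> f w <= g w)%E -> (upper_E Q f s <= upper_E Q g s)%E.
Proof.
move=> fg; apply: ereal_inf_le_tmp => _ [M [Msup Mb gM] <-].
by exists M => //; split=> // w sw; apply: le_trans (fg w sw) (gM w sw).
Qed.

Lemma le_cut_below (R : realType) (X : finType) (f : path_of X -> \bar R)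
    (a b : R) (w : path_of X) :
  a <= b -> (cut_below f a w <= cut_below f b w)%E.
Proof. by move=> ab; rewrite /cut_below ge_max !le_max lexx lee_fin ab orbT. Qed.

Lemma upper_E_inf_cut_below (R : realType) (X : finType)
    (Q : seq X -> (X -> \bar R) -> \bar R) (f : path_of X -> \bar R)
    (s : seq X) :
  upper_E Q f s = ereal_inf (range (fun a => upper_E Q (cut_below f a) s)).
Proof.
apply/eqP; rewrite eq_le; apply/andP; split.
  apply: le_ereal_inf_tmp => _ [a _ <-].
  by apply: upper_E_le => w _; rewrite /cut_below le_max lexx.
apply: le_ereal_inf_tmp => _ [M [Msup [c cM] fM] <-].
(* The cut level is the lower bound [c] of [M] itself, which makes [M] admissible for
   [cut_below f c] too. *)
apply: (@le_trans _ _ (upper_E Q (cut_below f c) s)).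
  by apply: ereal_inf_lbound; exists c.
apply: ereal_inf_lbound; exists M => //; split=> // [|w sw]; first by exists c.
by rewrite /cut_below ge_max fM //=; apply: limn_einf_ge => n.
Qed.

Theorem proposition26 (R : realType) (X : finType) (hX : (0 < #|X|)%N)
    (Q : seq X -> (X -> \bar R) -> \bar R) (hQ : imprecise_tree Q)
    (f : path_of X -> \bar R) (s : seq X) :
  upper_E Q (cut_below f a) s @[a --> -oo%R] --> upper_E Q f s.
Proof.
(* Substituting [- a] for [a] moves the limit to [+oo], where the function becomes nonincreasing and
   so tends to the infimum of its range. *)
rewrite upper_E_inf_cut_below cvgNy_compNP.
(* The infimum must be over the range of the reflected function; negation permutes the levels. *)
have -> : range (fun a => upper_E Q (cut_below f a) s) =
          range (fun a => upper_E Q (cut_below f (- a)) s).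
  by apply/seteqP; split=> _ [a _ <-]; exists (- a); rewrite ?opprK.
apply: nonincreasing_cvge => a b ab.
by apply: upper_E_le => w _; apply: le_cut_below; rewrite lerN2.
Qed.
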